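(* Let $K$ be a field, let $m,n\ge 3$ be integers, let $G_1,G_2$ be two connected graphs on the vertex sets $[m]$ and $[n]$, respectively, and let $R=S/J_{G_1,G_2}$. Then $R$ is c-universally Koszul if and only if $G_1$ and $G_2$ are complete graphs.
   Context: All graphs are finite and simple; $[m]=\{1,\dots,m\}$. Let $S=K[x_{ij}:1\le i\le m,\ 1\le j\le n]$ be the polynomial ring over $K$ with its standard grading. For $e=\{i,j\}\in E(G_1)$ with $i<j$ and $f=\{k,\ell\}\in E(G_2)$ with $k<\ell$ put $p_{ef}=x_{ik}x_{j\ell}-x_{i\ell}x_{jk}$. The binomial edge ideal of the pair $(G_1,G_2)$ is $J_{G_1,G_2}=(p_{ef}: e\in E(G_1),\ f\in E(G_2))\subset S$. Let $R$ be a standard graded $K$-algebra with graded maximal ideal $\mathfrak m$. A Koszul filtration of $R$ is a family $\mathcal F$ of ideals of $R$ generated by linear forms such that: (1) $\mathcal F$ contains the zero ideal and $\mathfrak m$; (2) for every non-zero ideal $I\in\mathcal F$ there exists $J\in\mathcal F$ such that $J\subset I$, $I/J$ is a cyclic module, and its annihilator $J:I$ belongs to $\mathcal F$. The algebra $R$ is called c-universally Koszul if the set of all ideals of $R$ generated by subsets of the variables (here, the residue classes $\overline{x}_{ij}$ of the variables $x_{ij}$ in $R=S/J_{G_1,G_2}$; the empty subset gives the zero ideal) is a Koszul filtration of $R$. *)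

(* Defs.v *)
From HB Require Import structures.
From mathcomp Require Import all_boot all_order all_algebra.
From mathcomp Require Import mpoly.
From mathcomp Require Import boolp classical_sets.

Set Implicit Arguments.
Unset Strict Implicit.
Unset Printing Implicit Defensive.

Import GRing.Theory.

Local Open Scope ring_scope.
Local Open Scope classical_set_scope.
Local Open Scope quotient_scope.

Definition simple_graph (T : finType) (e : rel T) : Prop :=
  ssrbool.symmetric e /\ irreflexive e.

Definition connected_graph (T : finType) (e : rel T) : Prop :=
  forall x y, connect e x y.

Definition complete_graph (T : finType) (e : rel T) : Prop :=
  forall x y, x != y -> e x y.

Definition ideal_gen (R : comNzRingType) (A : set R) : set R :=
  [set x | exists k (c a : 'I_k -> R),
             (forall i, A (a i)) /\ x = \sum_(i < k) c i * a i].

(* J : I; when J is contained in I it is the annihilator of I/J *)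
Definition colon (R : comNzRingType) (J I : set R) : set R :=
  [set r | forall x, I x -> J (r * x)].

(* I/J is generated, as an R-module, by the class of one element of I *)
Definition cyclic_quotient (R : comNzRingType) (I J : set R) : Prop :=
  exists2 a, I a & forall x, I x -> exists r, J (x - r * a).

(* In the next three definitions [gr d] is the set of homogeneous elements of
   degree d of a standard graded algebra R. *)
Definition max_graded (R : comNzRingType) (gr : nat -> set R) : set R :=
  ideal_gen [set x | exists2 d, (0 < d)%N & gr d x].

Definition Koszul_filtration (R : comNzRingType) (gr : nat -> set R)
    (F : set (set R)) : Prop :=
  [/\ forall I, F I -> exists2 A, A `<=` gr 1%N & I = ideal_gen A,
      F [set 0],
      F (max_graded gr)
    & forall I, F I -> I <> [set 0] ->
        exists J, [/\ F J, J `<=` I, cyclic_quotient I J & F (colon J I)]].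

Definition c_universally_Koszul (R : comNzRingType) (gr : nat -> set R)
    (vars : set R) : Prop :=
  Koszul_filtration gr [set I | exists2 A, A `<=` vars & I = ideal_gen A].

Section BinomialEdgeIdeal.
Variables (K : fieldType) (m n : nat) (e1 : rel 'I_m) (e2 : rel 'I_n).

Definition xvar (i : 'I_m) (j : 'I_n) : {mpoly K[m * n]} :=
  'X_(mxvec_index i j).

Definition binomial_edge_gens : set {mpoly K[m * n]} :=
  [set p | exists (i j : 'I_m) (k l : 'I_n),
     [/\ (i < j)%N, (k < l)%N, e1 i j, e2 k l
       & p = xvar i k * xvar j l - xvar i l * xvar j k]].

Definition binomial_edge_ideal : set {mpoly K[m * n]} :=
  ideal_gen binomial_edge_gens.

(* Boolean version, as required by the quotients of ring_quotient *)
Definition binomial_edge_idealb : pred {mpoly K[m * n]} :=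
  fun p => `[< binomial_edge_ideal p >].

Lemma binomial_edge_ideal_closed : idealr_closed binomial_edge_idealb.
Proof.
split.
- apply/asboolP; exists 0%N, (fun=> 0), (fun=> 0).
  by split=> [[] //|]; rewrite big_ord0.
- apply/asboolPn => -[k [c [a [ha]]]] /(congr1 (meval (fun=> 0))).
  rewrite meval1 raddf_sum big1 => [/eqP|i _]; first by rewrite oner_eq0.
  have [i1 [j1 [k1 [l1 [_ _ _ _ ->]]]]] := ha i.
  by rewrite /= !(mevalM, mevalB) !mevalXU !mul0r subrr mulr0.
- move=> a x y /asboolP[k [c [b [hb ->]]]] /asboolP[l [d [f [hf ->]]]].
  apply/asboolP; exists (k + l)%N.
  exists (fun i => match split i with inl j => a * c j | inr j => d j end).
  exists (fun i => match split i with inl j => b j | inr j => f j end).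
  split=> [i|]; first by case: (split i).
  rewrite big_split_ord mulr_sumr; congr (_ + _); apply: eq_bigr => i _.
    by rewrite -[lshift _ _]/(unsplit (inl i)) unsplitK mulrA.
  by rewrite -[rshift _ _]/(unsplit (inr i)) unsplitK.
Qed.

HB.instance Definition _ :=
  isIdealr.Build {mpoly K[m * n]} binomial_edge_idealb
    binomial_edge_ideal_closed.

Definition binomial_edge_idealr : idealr {mpoly K[m * n]} := binomial_edge_idealb.

Definition binomial_edge_ring : comNzRingType := {ideal_quot binomial_edge_idealr}.

Definition binomial_edge_ring_class (p : {mpoly K[m * n]}) : binomial_edge_ring :=
  \pi_({ideal_quot binomial_edge_idealr}) p.

Definition binomial_edge_ring_grading (d : nat) : set binomial_edge_ring :=
  binomial_edge_ring_class @` [set p | p \is d.-homog].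

Definition binomial_edge_ring_vars : set binomial_edge_ring :=
  [set binomial_edge_ring_class (xvar ij.1 ij.2) | ij in [set: 'I_m * 'I_n]].

End BinomialEdgeIdeal.

Arguments binomial_edge_ring_grading K {m n} e1 e2 d _ : rename.
Arguments binomial_edge_ring_vars K {m n} e1 e2 _.

(* Main.v *)
Require Import Defs.
From HB Require Import structures.
From mathcomp Require Import all_boot all_order all_algebra.
From mathcomp Require Import mpoly.
From mathcomp Require Import boolp classical_sets.
From mathcomp Require Import ring.

(** The ring R is S / J, with J the binomial edge ideal.

    Complete graphs: J is then the ideal of 2-minors of the generic m x n
    matrix, and x_ij |-> s_i t_j maps R onto a Segre product inside
    K[s_1..s_m, t_1..t_n].  The image of a monomial is determined by its
    margin, that is, the row and column sums of its exponent matrix, and two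
    monomials with the same margin are congruent modulo the 2-minors
    (monomial_class_margin).  So every element of R is a combination of
    monomials whose coefficients can be read off in K[s, t]
    (ideal_gen_by_margins).  Let B be a set of variables and x_ij a variable
    outside B.  If a monomial u occurs in an element of (B) : x_ij, then the
    margin of u x_ij is at least that of some x_kl in B, and in each of the
    cases k = i, l = j, or neither, u is divisible in R by a variable c with
    c x_ij in (B).  Thus (B) : x_ij is generated by variables (colon_var), and
    removing any one variable from a nonempty set of variables gives the
    required step of a Koszul filtration.

    Conversely, let the variables generate a Koszul filtration.  The only
    ideal of the family that can serve as J for I = (x_ij) is the zero ideal,
    so the annihilator of x_ij is generated by variables; no product of two
    variables vanishes in R, because J vanishes at the all-ones matrix, so
    x_ij is a nonzerodivisor (var_nonzerodivisor).  If G1 is connected but not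
    complete, it has an induced path a - b - c, and for every edge {k, l} of G2
    the minor on rows a, c and columns k, l is killed by x_bk.  That minor is
    not zero in R: it does not vanish at the matrix whose only nonzero entries
    are ones in positions (a, k) and (c, l), whereas J does.  The
    same argument with an induced path in G2 shows that G2 is complete. *)

Set Implicit Arguments.
Unset Strict Implicit.
Unset Printing Implicit Defensive.

Import GRing.Theory.

Local Open Scope ring_scope.
Local Open Scope classical_set_scope.

(** * Ideals generated by a set *)

Section IdealGen.
Variable R : comNzRingType.
Implicit Types (A B D : set R) (x y r : R).

Lemma ideal_gen_sub A : A `<=` ideal_gen A.
Proof.
move=> a Aa; exists 1%N, (fun=> 1), (fun=> a).
by split=> //; rewrite big_ord1 mul1r.
Qed.

Lemma ideal_gen0 A : ideal_gen A 0.
Proof. by exists 0%N, (fun=> 0), (fun=> 0); split=> [[] //|]; rewrite big_ord0. Qed.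

Lemma ideal_genD A x y : ideal_gen A x -> ideal_gen A y -> ideal_gen A (x + y).
Proof.
move=> [k [c [a [ha ->]]]] [l [d [b [hb ->]]]]; exists (k + l)%N.
exists (fun i => match split i with inl j => c j | inr j => d j end).
exists (fun i => match split i with inl j => a j | inr j => b j end).
split=> [i|]; first by case: (split i).
rewrite big_split_ord; congr (_ + _); apply: eq_bigr => i _.
  by rewrite -[lshift _ _]/(unsplit (inl i)) unsplitK.
by rewrite -[rshift _ _]/(unsplit (inr i)) unsplitK.
Qed.

Lemma ideal_genM A r x : ideal_gen A x -> ideal_gen A (r * x).
Proof.
move=> [k [c [a [ha ->]]]]; exists k, (fun i => r * c i), a; split=> //.
by rewrite mulr_sumr; apply: eq_bigr => i _; rewrite mulrA.
Qed.

Lemma ideal_gen_sum A (I : Type) (s : seq I) (P : pred I) (F : I -> R) :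
  (forall i, P i -> ideal_gen A (F i)) -> ideal_gen A (\sum_(i <- s | P i) F i).
Proof. by apply: big_ind; [exact: ideal_gen0 | move=> x y; apply: ideal_genD]. Qed.

Lemma ideal_gen_min A D : D 0 -> (forall x y, D x -> D y -> D (x + y)) ->
  (forall r x, D x -> D (r * x)) -> A `<=` D -> ideal_gen A `<=` D.
Proof.
move=> D0 DD DM AD _ [k [c [a [ha ->]]]].
by apply: big_ind => // i _; apply/DM/AD/ha.
Qed.

Lemma ideal_gen_subset A B : A `<=` ideal_gen B -> ideal_gen A `<=` ideal_gen B.
Proof.
apply: ideal_gen_min; [exact: ideal_gen0| |exact: ideal_genM].
by move=> x y; apply: ideal_genD.
Qed.

Lemma ideal_gen_set0 : ideal_gen (set0 : set R) = [set 0].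
Proof.
apply/seteqP; split=> [|_ ->]; last exact: ideal_gen0.
by apply: ideal_gen_min => //= [x y -> ->|r x ->]; rewrite ?addr0 ?mulr0.
Qed.

Lemma cyclic_quotient_setD1 A a : A a ->
  cyclic_quotient (ideal_gen A) (ideal_gen (A `\ a)).
Proof.
move=> Aa; exists a; first exact: ideal_gen_sub.
apply: ideal_gen_min => [|x y [r hr] [s hs]|s x [r hr]|b Ab].
- by exists 0; rewrite mul0r subr0; apply: ideal_gen0.
- exists (r + s); rewrite mulrDl opprD addrACA; exact: ideal_genD.
- by exists (s * r); rewrite -mulrA -mulrBr; apply: ideal_genM.
- have [->|/eqP ba] := eqVneq b a.
    by exists 1; rewrite mul1r subrr; apply: ideal_gen0.
  by exists 0; rewrite mul0r subr0; apply: ideal_gen_sub.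
Qed.

Lemma ideal_gen_ker (T : comNzRingType) (g : {rmorphism R -> T}) A :
  (forall a, A a -> g a = 0) -> forall x, ideal_gen A x -> g x = 0.
Proof.
move=> gA x [k [c [a [ha ->]]]].
by rewrite rmorph_sum big1 // => i _; rewrite rmorphM (gA _ (ha i)) mulr0.
Qed.

End IdealGen.

(** * Homomorphisms out of the quotient ring, and its monomials *)

Lemma mnm_neq0_exists p (u : 'X_{1..p}) : u != 0%MM -> exists v, u v != 0%N.
Proof.
move=> u0; apply/existsP; apply: contraNT u0 => /existsPn u0.
by apply/eqP/mnmP => v; apply/eqP; rewrite mnm0E -[_ == _]negbK u0.
Qed.

Section RingHom.
Variables (K : fieldType) (m n : nat) (e1 : rel 'I_m) (e2 : rel 'I_n).
Local Notation R := (binomial_edge_ring K e1 e2).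
Local Notation pi := (@binomial_edge_ring_class K m n e1 e2).
Local Notation x := (fun i j => pi (xvar K i j)).

Lemma piB p q : pi (p - q) = pi p - pi q. Proof. exact: rmorphB. Qed.
Lemma piM p q : pi (p * q) = pi p * pi q. Proof. exact: rmorphM. Qed.
Lemma pi1 : pi 1 = 1. Proof. exact: rmorph1. Qed.

Lemma pi_eqP p q : pi p = pi q <-> binomial_edge_ideal e1 e2 (p - q).
Proof.
have -> : binomial_edge_ideal e1 e2 (p - q) <->
   p - q \in (binomial_edge_idealr K e1 e2 : pred _).
  by split=> /asboolP.
by rewrite Quotient.idealrBE; split=> [/eqP|/eqP].
Qed.

Lemma pi_surj (r : R) : exists p, r = pi p.
Proof. by exists (repr r); rewrite /binomial_edge_ring_class reprK. Qed.

Section Lift.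
Variables (T : comNzRingType) (f : {rmorphism {mpoly K[m * n]} -> T}).
Hypothesis f_gens : forall p, binomial_edge_gens e1 e2 p -> f p = 0.

Definition ring_lift : R -> T := fun r => f (repr r).

Lemma ring_liftE p : ring_lift (pi p) = f p.
Proof.
apply/eqP; rewrite -subr_eq0 -rmorphB; apply/eqP.
have /pi_eqP : pi (repr (pi p)) = pi p by rewrite /binomial_edge_ring_class reprK.
case=> k [c [a [ha ->]]].
by rewrite rmorph_sum big1 // => i _; rewrite rmorphM (f_gens (ha i)) mulr0.
Qed.

Fact ring_lift_zmod : zmod_morphism ring_lift.
Proof.
move=> r s; have [p ->] := pi_surj r; have [q ->] := pi_surj s.
by rewrite -piB !ring_liftE rmorphB.
Qed.

Fact ring_lift_monoid : monoid_morphism ring_lift.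
Proof.
split=> [|r s]; first by rewrite -pi1 ring_liftE rmorph1.
have [p ->] := pi_surj r; have [q ->] := pi_surj s.
by rewrite -piM !ring_liftE rmorphM.
Qed.

HB.instance Definition _ := GRing.isZmodMorphism.Build R T ring_lift ring_lift_zmod.
HB.instance Definition _ := GRing.isMonoidMorphism.Build R T ring_lift ring_lift_monoid.

Lemma ring_lift_exists : exists g : {rmorphism R -> T}, forall p, g (pi p) = f p.
Proof. by exists ring_lift; apply: ring_liftE. Qed.

End Lift.

(** The universal property of the quotient: a homomorphism is a matrix whose
    minors on the edges vanish.  Both the Segre map and the evaluations at
    points of K^(m x n) come from it. *)
Lemma binomial_edge_ring_hom (T : comNzRingType) (f : {rmorphism K -> T})
    (y : 'M[T]_(m, n)) :
    (forall i j k l, e1 i j -> e2 k l -> y i k * y j l = y i l * y j k) ->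
  exists g : {rmorphism R -> T},
    (forall c, g (pi c%:MP) = f c) /\ (forall i j, g (x i j) = y i j).
Proof.
move=> hy; pose h k := mxvec y 0 k.
have mmap_x i j : mmap f h (xvar K i j) = y i j.
  by rewrite /xvar mmapX mmap1U /h mxvecE.
have [|g gE] := @ring_lift_exists T (mmap f h).
  move=> _ [i [j [k [l [_ _ eij ekl ->]]]]].
  by rewrite rmorphB !rmorphM /= !mmap_x (hy _ _ _ _ eij ekl) subrr.
by exists g; split=> [c|i j]; rewrite gE /= ?mmapC ?mmap_x.
Qed.

(** The generators are indexed by ordered edges; symmetry and irreflexivity of
    the graphs extend the relation to either orientation. *)
Lemma var_swap (G1 : simple_graph e1) (G2 : simple_graph e2) i j k l :
  e1 i j -> e2 k l -> x i k * x j l = x i l * x j k.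
Proof.
have swap (i' j' : 'I_m) (k' l' : 'I_n) :
    (i' < j')%N -> (k' < l')%N -> e1 i' j' -> e2 k' l' ->
    x i' k' * x j' l' = x i' l' * x j' k'.
  move=> ij kl eij ekl; rewrite -!piM; apply/pi_eqP/ideal_gen_sub.
  by exists i', j', k', l'.
have [sym1 irr1] := G1; have [sym2 irr2] := G2.
move=> eij ekl.
case: (ltngtP i j) => [ij|ji|/val_inj ij]; last by rewrite ij irr1 in eij.
  case: (ltngtP k l) => [kl|lk|/val_inj kl]; last by rewrite kl irr2 in ekl.
    exact: swap.
  by rewrite (swap i j l k) // sym2.
case: (ltngtP k l) => [kl|lk|/val_inj kl]; last by rewrite kl irr2 in ekl.
  by rewrite [RHS]mulrC (swap _ _ _ _ ji kl) 1?sym1 // mulrC.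
by rewrite mulrC (swap _ _ _ _ ji lk) 1?sym1 1?sym2 // mulrC.
Qed.

Lemma var_swap_complete (G1 : simple_graph e1) (G2 : simple_graph e2)
    (h1 : complete_graph e1) (h2 : complete_graph e2) i j k l :
  x i k * x j l = x i l * x j k.
Proof.
have [->|ij] := eqVneq i j; first exact: mulrC.
have [->//|kl] := eqVneq k l.
by apply: var_swap => //; [apply: h1 | apply: h2].
Qed.

Lemma var_graded i j : binomial_edge_ring_grading K e1 e2 1 (x i j).
Proof. by exists (xvar K i j) => //=; rewrite dhomogX /= mdeg1. Qed.

Definition monomial_class (u : 'X_{1..m * n}) : R := pi 'X_[u].
Local Notation mon := monomial_class.

Lemma monD u v : mon (u + v)%MM = mon u * mon v.
Proof. by rewrite /monomial_class mpolyXD piM. Qed.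

Lemma monU i j : mon U_(mxvec_index i j) = x i j. Proof. by []. Qed.

Lemma mnm_var_factor (u : 'X_{1..m * n}) i j : u (mxvec_index i j) != 0%N ->
  u = (U_(mxvec_index i j) + (u - U_(mxvec_index i j)))%MM.
Proof. by move=> uij; rewrite addmC submK // lep1mP. Qed.

Lemma pi_expand p : pi p = \sum_(u <- msupp p) pi (p@_u)%:MP * mon u.
Proof.
rewrite {1}[p]mpolyE [LHS]rmorph_sum; apply: eq_bigr => u _.
by rewrite -mul_mpolyC; apply: rmorphM.
Qed.

Lemma max_graded_vars :
  max_graded (binomial_edge_ring_grading K e1 e2) =
  ideal_gen (binomial_edge_ring_vars K e1 e2).
Proof.
apply/seteqP; split; apply: ideal_gen_subset; last first.
  move=> _ [[i j] _ <-]; apply: ideal_gen_sub; exists 1%N => //; exact: var_graded.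
move=> _ [d d0 [p /dhomogP hp <-]]; rewrite pi_expand big_seq.
apply: ideal_gen_sum => u /hp /= du; apply: ideal_genM.
have /mnm_neq0_exists[v uv] : u != 0%MM by rewrite -mdeg_eq0 du -lt0n.
case/mxvec_indexP: v uv => i j uij.
rewrite (mnm_var_factor uij) monD monU mulrC.
by apply/ideal_genM/ideal_gen_sub; exists (i, j).
Qed.

End RingHom.

(** * Row and column sums of an exponent matrix *)

Section Margin.
Variables (m n : nat).

Definition margin (u : 'X_{1..m * n}) : 'X_{1..m + n} :=
  [multinom match split k with
            | inl i => \sum_(j < n) u (mxvec_index i j)
            | inr j => \sum_(i < m) u (mxvec_index i j)
            end | k < m + n].

Lemma margin_row u i : margin u (lshift n i) = (\sum_(j < n) u (mxvec_index i j))%N.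
Proof. by rewrite mnmE -[lshift _ _]/(unsplit (inl i)) unsplitK. Qed.

Lemma margin_col u j : margin u (rshift m j) = (\sum_(i < m) u (mxvec_index i j))%N.
Proof. by rewrite mnmE -[rshift _ _]/(unsplit (inr j)) unsplitK. Qed.

Lemma margin0 : margin 0%MM = 0%MM.
Proof.
apply/mnmP => k; rewrite mnm0E mnmE.
by case: (split k) => a; rewrite big1 // => b _; rewrite mnm0E.
Qed.

Lemma marginD u v : margin (u + v)%MM = (margin u + margin v)%MM.
Proof.
apply/mnmP => k; rewrite mnmDE !mnmE.
by case: (split k) => a; rewrite -big_split; apply: eq_bigr => b _; rewrite mnmDE.
Qed.

Lemma mxvec_index_eq (i i' : 'I_m) (j j' : 'I_n) :
  (mxvec_index i j == mxvec_index i' j') = (i == i') && (j == j').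
Proof.
by rewrite /mxvec_index (inj_eq (@cast_ord_inj _ _ _)) (inj_eq enum_rank_inj) xpair_eqE.
Qed.

Lemma marginU i j :
  margin U_(mxvec_index i j) = (U_(lshift n i) + U_(rshift m j))%MM.
Proof.
apply/mnmP => k; case: (split_ordP k) => a ->; rewrite ?margin_row ?margin_col.
  rewrite mnmDE !mnm1E eq_lshift eq_rlshift addn0 (bigD1 j) //= big1 => [|b bj].
    by rewrite mnm1E mxvec_index_eq eqxx andbT addn0.
  by rewrite mnm1E mxvec_index_eq eq_sym (eq_sym j) (negPf bj) andbF.
rewrite mnmDE !mnm1E eq_rshift eq_lrshift add0n (bigD1 i) //= big1 => [|b bi].
  by rewrite mnm1E mxvec_index_eq eqxx addn0.
by rewrite mnm1E mxvec_index_eq (eq_sym i) (negPf bi).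
Qed.

Lemma margin_row_neq0 u i :
  margin u (lshift n i) != 0%N -> exists j, u (mxvec_index i j) != 0%N.
Proof. by rewrite margin_row sum_nat_eq0 => /forallPn. Qed.

Lemma margin_col_neq0 u j :
  margin u (rshift m j) != 0%N -> exists i, u (mxvec_index i j) != 0%N.
Proof. by rewrite margin_col sum_nat_eq0 => /forallPn. Qed.

Lemma margin_eq0 u : margin u = 0%MM -> u = 0%MM.
Proof.
move=> mu0; apply/eqP/contraT => /mnm_neq0_exists [v].
case/mxvec_indexP: v => i j; have := margin_row u i.
by rewrite mu0 mnm0E => /esym/eqP; rewrite sum_nat_eq0 => /forallP/(_ j)/= ->.
Qed.

End Margin.

(** * Complete graphs: the Segre product *)

Section Segre.
Variables (K : fieldType) (m n : nat) (e1 : rel 'I_m) (e2 : rel 'I_n).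
Hypotheses (G1 : simple_graph e1) (G2 : simple_graph e2).
Hypotheses (h1 : complete_graph e1) (h2 : complete_graph e2).
Local Notation R := (binomial_edge_ring K e1 e2).
Local Notation pi := (@binomial_edge_ring_class K m n e1 e2).
Local Notation x := (fun i j => pi (xvar K i j)).
Local Notation mon := (monomial_class K e1 e2).

Lemma segre_map : exists g : {rmorphism R -> {mpoly K[m + n]}},
  (forall c, g (pi c%:MP) = c%:MP) /\ (forall u, g (mon u) = 'X_[margin u]).
Proof.
pose y : 'M[{mpoly K[m + n]}]_(m, n) :=
  \matrix_(i, j) 'X_[U_(lshift n i) + U_(rshift m j)].
have [|g [gC gx]] := @binomial_edge_ring_hom K m n e1 e2 _ (@mpolyC _ _) y.
  by move=> i j k l _ _; rewrite !mxE !mpolyXD; ring.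
exists g; split=> // u.
have [d] := ubnP (mdeg u); elim: d u => // d IH u.
have [->|/mnm_neq0_exists[v]] := eqVneq u 0%MM.
  by move=> _; rewrite margin0 /monomial_class !mpolyX0 pi1 rmorph1.
case/mxvec_indexP: v => i j /mnm_var_factor -> ltd.
rewrite monD rmorphM monU gx mxE IH; last first.
  by rewrite mdegD mdeg1 add1n ltnS in ltd.
by rewrite marginD marginU -mpolyXD.
Qed.

(** If row i and column j are both occupied in u, by (i, l) and (k, j) say,
    then x_il x_kj = x_ij x_kl in R brings a factor x_ij to light. *)
Lemma monomial_class_divide u i j : margin u (lshift n i) != 0%N -> margin u (rshift m j) != 0%N ->
  exists2 w, mon u = x i j * mon w &
    margin u = (margin U_(mxvec_index i j) + margin w)%MM.
Proof.
move=> /margin_row_neq0[l ul] /margin_col_neq0[k uk].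
have [uij|] := boolP (u (mxvec_index i j) != 0%N).
  exists (u - U_(mxvec_index i j))%MM; rewrite -?marginD -?mnm_var_factor //.
  by rewrite {1}(mnm_var_factor uij) monD.
rewrite negbK => /eqP uij0.
have jl : (l == j) = false by apply: contraNF ul => /eqP ->; rewrite uij0.
rewrite (mnm_var_factor ul); set w := (u - _)%MM.
have /mnm_var_factor -> : w (mxvec_index k j) != 0%N.
  by rewrite mnmBE mnm1E mxvec_index_eq jl andbF subn0.
set w' := (w - _)%MM; exists (U_(mxvec_index k l) + w')%MM.
  by rewrite !monD !monU !mulrA (var_swap_complete K G1 G2 h1 h2).
rewrite !marginD !marginU; apply/mnmP => a; rewrite !mnmDE; ring.
Qed.

(** Injectivity of the Segre map on monomials.  A variable dividing u occupies
    a row and a column of u' as well, so monomial_class_divide splits it off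
    from u' too, and the cofactors again have equal margins. *)
Lemma monomial_class_margin u u' : margin u = margin u' -> mon u = mon u'.
Proof.
have [d] := ubnP (mdeg u); elim: d u u' => // d IH u u'.
have [->|/mnm_neq0_exists[v]] := eqVneq u 0%MM.
  by move=> _ mu; congr mon; apply/esym/margin_eq0; rewrite -mu margin0.
case/mxvec_indexP: v => i j /mnm_var_factor -> ltd mu.
have [||w -> mw] := @monomial_class_divide u' i j.
- by rewrite -mu marginD marginU !mnmDE !mnm1E eqxx.
- by rewrite -mu marginD marginU !mnmDE !mnm1E eqxx addnAC addnC.
rewrite monD; congr (_ * _); apply: IH.
  by rewrite mdegD mdeg1 add1n ltnS in ltd.
by move: mu; rewrite mw marginD; apply: addmI.
Qed.

(** Grouping the monomials of a representative of r by margin writes r as the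
    sum, over the margins d, of the coefficient of g r at d times any monomial
    of margin d; only the margins in the support of g r survive. *)
Lemma ideal_gen_by_margins (g : {rmorphism R -> {mpoly K[m + n]}}) (A : set R) r :
    (forall c, g (pi c%:MP) = c%:MP) -> (forall u, g (mon u) = 'X_[margin u]) ->
    (forall u, (g r)@_(margin u) != 0 -> ideal_gen A (mon u)) ->
  ideal_gen A r.
Proof.
move=> gC gmon; have [p ->] := pi_surj r => hA.
pose D := undup [seq margin u | u <- msupp p].
have gp d : (g (pi p))@_d = \sum_(u <- msupp p | margin u == d) p@_u.
  rewrite pi_expand rmorph_sum raddf_sum /= [RHS]big_mkcond; apply: eq_bigr => u _.
  by rewrite rmorphM gC gmon mcoeffCM mcoeffX; case: eqP; rewrite ?mulr1 ?mulr0.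
have -> : pi p = \sum_(d <- D) \sum_(u <- msupp p | margin u == d) pi (p@_u)%:MP * mon u.
  rewrite pi_expand (exchange_big_dep xpredT) //=; apply: eq_big_seq => u up.
  rewrite (eq_bigl (pred1 (margin u))) => [|d]; last exact: eq_sym.
  rewrite -big_filter filter_pred1_uniq ?undup_uniq ?big_seq1 //.
  by rewrite mem_undup map_f.
rewrite big_seq; apply: ideal_gen_sum => d; rewrite mem_undup => /mapP[u0 _ ->].
rewrite (eq_bigr (fun u => pi (p@_u)%:MP * mon u0)) => [|u /eqP/monomial_class_margin -> //].
rewrite -mulr_suml.
have -> : \sum_(u <- msupp p | margin u == margin u0) pi (p@_u)%:MP =
    pi ((g (pi p))@_(margin u0))%:MP.
  by rewrite gp [in RHS]raddf_sum [RHS]rmorph_sum.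
have [->|/hA] := eqVneq ((g (pi p))@_(margin u0)) 0; last exact: ideal_genM.
by rewrite [_%:MP]raddf0 [pi _]rmorph0 mul0r; apply: ideal_gen0.
Qed.

(** The colon ideal is (B) plus the variables of column l for each x_il in B
    and those of row k for each x_kj in B.  Describing its generators as the
    variables c with c x_ij in (B) makes the opposite inclusion immediate. *)
Lemma colon_var (B : set R) i j :
    B `<=` binomial_edge_ring_vars K e1 e2 -> ~ B (x i j) ->
  forall r, ideal_gen B (r * x i j) ->
    ideal_gen [set c | binomial_edge_ring_vars K e1 e2 c /\ ideal_gen B (c * x i j)] r.
Proof.
move=> Bvars Bij r; have [g [gC gmon]] := segre_map.
move=> [k [c [b [hb rx]]]].
apply: (ideal_gen_by_margins gC gmon) => u ru0.
have : (g (r * x i j))@_(margin (U_(mxvec_index i j) + u)) != 0.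
  by rewrite rmorphM -monU gmon marginD mcoeffMX.
rewrite rx rmorph_sum raddf_sum /=.
(* The coefficient of r x_ij at this margin is nonzero, so some term c_t b_t
   of its expression in (B) contributes to it: the margin of the variable b_t
   is at most that of u x_ij. *)
have [t ht|none] := pickP (fun t => (g (c t * b t))@_(margin (U_(mxvec_index i j) + u)) != 0);
  last by rewrite big1 ?eqxx // => t _; apply/eqP/negbFE/none.
move=> _; have [[k' l] _ /= bt] := Bvars _ (hb t).
move: (hb t) ht; rewrite -bt => Bkl.
rewrite rmorphM -monU gmon -mcoeff_msupp (perm_mem (msuppMX _ _)) => /mapP[w _ mw].
have div i' j' : margin u (lshift n i') != 0%N -> margin u (rshift m j') != 0%N ->
    ideal_gen B (x i' j' * x i j) ->
    ideal_gen [set c | binomial_edge_ring_vars K e1 e2 c /\ ideal_gen B (c * x i j)] (mon u).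
  move=> ui uj hB; have [w' -> _] := monomial_class_divide ui uj; rewrite mulrC.
  by apply/ideal_genM/ideal_gen_sub; split=> //; exists (i', j').
have Bx y : ideal_gen B (y * x k' l) by apply/ideal_genM/ideal_gen_sub.
have urow : k' != i -> margin u (lshift n k') != 0%N.
  move=> ki; have /mnmP/(_ (lshift n k')) := mw.
  rewrite marginD !marginU !mnmDE !mnm1E !eq_lshift !eq_rlshift eqxx eq_sym (negPf ki).
  by rewrite !add0n => ->.
have ucol : l != j -> margin u (rshift m l) != 0%N.
  move=> lj; have /mnmP/(_ (rshift m l)) := mw.
  rewrite marginD !marginU !mnmDE !mnm1E !eq_rshift !eq_lrshift eqxx eq_sym (negPf lj).
  by rewrite !add0n => ->.
have pos_row p q : u (mxvec_index p q) != 0%N -> margin u (lshift n p) != 0%N.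
  by rewrite margin_row sum_nat_eq0 => upq; apply/forallPn; exists q.
have pos_col p q : u (mxvec_index p q) != 0%N -> margin u (rshift m q) != 0%N.
  by rewrite margin_col sum_nat_eq0 => upq; apply/forallPn; exists p.
(* In the two mixed cases the divisor of u lies in the column, or row, of
   x_kl, and exchanging it with x_ij produces x_kl itself. *)
have [ki|ki] := eqVneq k' i; have [lj|lj] := eqVneq l j.
- by case: Bij; rewrite -ki -lj.
- have /margin_col_neq0[p up] := ucol lj.
  apply: (div p l); rewrite ?(pos_row _ _ up) ?(pos_col _ _ up) //.
  by rewrite (var_swap_complete K G1 G2 h1 h2) -ki; apply: Bx.
- have /margin_row_neq0[q uq] := urow ki.
  apply: (div k' q); rewrite ?(pos_row _ _ uq) ?(pos_col _ _ uq) //.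
  by rewrite (var_swap_complete K G1 G2 h1 h2) mulrC -lj; apply: Bx.
- by apply: (div k' l); rewrite ?urow ?ucol // mulrC; apply: Bx.
Qed.

Lemma complete_c_universally_Koszul :
  c_universally_Koszul (binomial_edge_ring_grading K e1 e2)
                       (binomial_edge_ring_vars K e1 e2).
Proof.
split.
- move=> _ [A hA ->]; exists A => // a /hA [[i j] _ <-]; exact: var_graded.
- by exists set0 => //; rewrite ideal_gen_set0.
- by exists (binomial_edge_ring_vars K e1 e2); rewrite ?max_graded_vars.
move=> _ [A hA ->] An0.
have [a Aa] : exists a, A a.
  by apply/set0P/eqP => A0; apply: An0; rewrite A0 ideal_gen_set0.
have Asub : A `\ a `<=` A by move=> b [].
exists (ideal_gen (A `\ a)); split.
- by exists (A `\ a) => //; apply: subset_trans hA.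
- by apply/ideal_gen_subset => b /Asub; apply: ideal_gen_sub.
- exact: cyclic_quotient_setD1.
exists [set c | binomial_edge_ring_vars K e1 e2 c /\ ideal_gen (A `\ a) (c * a)].
  by move=> c [].
have [[i j] _ /= aij] := hA _ Aa.
apply/seteqP; split=> r.
  move=> /(_ a (ideal_gen_sub Aa)); rewrite -aij; apply: colon_var.
    exact: subset_trans hA.
  by move=> [_]; apply.
apply: (ideal_gen_min (D := colon _ _)) => {r}.
- by move=> z _; rewrite mul0r; apply: ideal_gen0.
- by move=> r s hr hs z Az; rewrite mulrDl; apply: ideal_genD; [apply: hr|apply: hs].
- by move=> r s hs z Az; rewrite -mulrA; apply/ideal_genM/hs.
move=> c [_ hc] z; move: z; apply: ideal_gen_min => [|y z|r z|b Ab].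
- by rewrite mulr0; apply: ideal_gen0.
- by rewrite mulrDr; apply: ideal_genD.
- by rewrite mulrCA; apply: ideal_genM.
have [->//|/eqP ba] := eqVneq b a.
by apply/ideal_genM/ideal_gen_sub.
Qed.

End Segre.

(** * Induced paths in connected graphs *)

Section Graphs.
Variables (T : finType) (e : rel T).

Lemma connected_neighbor x y :
  connected_graph e -> x != y -> exists z, e x z.
Proof.
move=> /(_ x y) /connectP[[|z p] /= + ->]; first by rewrite eqxx.
by move=> /andP[xz _] _; exists z.
Qed.

(** A relation without induced path on three vertices is transitive on
    distinct vertices, so walks can be shortened to single edges. *)
Lemma connected_induced_path : connected_graph e -> ~ complete_graph e ->
  exists a b c, [/\ e a b, e b c, a != c & ~~ e a c].
Proof.
move=> conn ncompl; apply: contrapT => noP; apply: ncompl => x y xy.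
have tr a b c : e a b -> e b c -> a != c -> e a c.
  by move=> ab bc ac; apply: contrapT => /negP nac; apply: noP; exists a, b, c.
have /connectP[p + def_y] := conn x y.
elim: p x xy def_y => [|z p IH] x xy /= def_y; first by rewrite def_y eqxx in xy.
move=> /andP[xz zp]; have [<-//|zy] := eqVneq z y.
exact: tr xz (IH z zy def_y zp) xy.
Qed.

End Graphs.

(** * Universal filtrations force completeness *)

Lemma minor_annihilated (S : comNzRingType) (p q r s u v : S) :
  p * v = r * u -> u * q = v * s -> (p * q - r * s) * u = 0.
Proof.
move=> pv uq; rewrite mulrBl -mulrA (mulrC q) uq mulrA pv.
by rewrite mulrAC subrr.
Qed.

Section Converse.
Variables (K : fieldType) (m n : nat) (e1 : rel 'I_m) (e2 : rel 'I_n).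
Hypotheses (G1 : simple_graph e1) (G2 : simple_graph e2).
Local Notation R := (binomial_edge_ring K e1 e2).
Local Notation pi := (@binomial_edge_ring_class K m n e1 e2).
Local Notation x := (fun i j => pi (xvar K i j)).

Lemma evaluation (y : 'M[K]_(m, n)) :
    (forall i j k l, e1 i j -> e2 k l -> y i k * y j l = y i l * y j k) ->
  exists g : {rmorphism R -> K}, forall i j, g (x i j) = y i j.
Proof.
move=> hy; have [g [_ gx]] := @binomial_edge_ring_hom K m n e1 e2 K idfun y hy.
by exists g.
Qed.

Lemma evaluation_const (c : K) :
  exists g : {rmorphism R -> K}, forall i j, g (x i j) = c.
Proof.
have [|g gx] := @evaluation (const_mx c); first by move=> *; rewrite !mxE.
by exists g => i j; rewrite gx mxE.
Qed.

(** Every generator involves only products of two entries lying in the rows and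
    columns of a pair of edges; a 0-1 matrix avoiding such pairs of ones makes
    each of these products zero. *)
Lemma evaluation_indicator (P : 'I_m -> 'I_n -> bool) :
    (forall i j k l, P i k -> P j l -> ~~ (e1 i j && e2 k l) && ~~ (e1 i j && e2 l k)) ->
  exists g : {rmorphism R -> K}, forall i j, g (x i j) = (P i j)%:R.
Proof.
move=> hP; have [|g gx] := @evaluation (\matrix_(i, j) (P i j)%:R); last first.
  by exists g => i j; rewrite gx mxE.
move=> i j k l eij ekl; rewrite !mxE -!natrM !mulnb.
case: andP => [[Pik Pjl]|_]; first by have := hP _ _ _ _ Pik Pjl; rewrite eij ekl.
case: andP => [[Pil Pjk]|//]; have := hP _ _ _ _ Pil Pjk.
by rewrite eij ekl andbF.
Qed.

Lemma evaluation_point i0 j0 :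
  exists g : {rmorphism R -> K}, forall i j, g (x i j) = ((i == i0) && (j == j0))%:R.
Proof.
apply: (evaluation_indicator (P := fun i j => (i == i0) && (j == j0))).
move=> i j k l /andP[/eqP-> _] /andP[/eqP-> _].
by have [_ irr] := G1; rewrite irr.
Qed.

(** For I = (x_ij) the filtration must provide J = (B) inside I with B a set of
    variables, hence B is empty or {x_ij}.  The latter gives J : I = R, which is
    not generated by variables; so J = 0 and the annihilator of x_ij is
    generated by variables, none of which can kill x_ij. *)
Lemma var_nonzerodivisor (U : c_universally_Koszul (binomial_edge_ring_grading K e1 e2)
    (binomial_edge_ring_vars K e1 e2)) i j (q : R) :
  q * x i j = 0 -> q = 0.
Proof.
move=> qx0; have [_ _ _ H] := U.
have IF : [set I | exists2 A, A `<=` binomial_edge_ring_vars K e1 e2 &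
    I = ideal_gen A] (ideal_gen [set x i j]).
  by exists [set x i j] => // _ ->; exists (i, j).
have [|J [[B Bvars ->] BI _ [C Cvars defC]]] := H _ IF.
  move=> I0; have : ideal_gen [set x i j] (x i j) by apply: ideal_gen_sub.
  rewrite I0 /= => x0; have [g gx] := evaluation_const 1.
  by have /eqP := gx i j; rewrite x0 rmorph0 eq_sym oner_eq0.
have Bx b : B b -> b = x i j.
  move=> Bb; have [[k l] _ /= bkl] := Bvars _ Bb; rewrite -bkl.
  have [/andP[/eqP-> /eqP->] //|ne] := boolP ((i == k) && (j == l)).
  have [g gx] := evaluation_point k l.
  have : g b = 0.
    apply: (ideal_gen_ker _ (BI _ (ideal_gen_sub Bb))) => _ ->.
    by rewrite gx (negPf ne).
  by move=> /eqP; rewrite -bkl gx !eqxx oner_eq0.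
have [B0|/set0P[b Bb]] := eqVneq B set0; last first.
  have : colon (ideal_gen B) (ideal_gen [set x i j]) 1.
    move=> z; rewrite mul1r; apply: ideal_gen_subset => _ ->.
    by rewrite -(Bx b) //; apply: ideal_gen_sub.
  rewrite defC; have [g gx] := evaluation_const 0.
  move=> /(ideal_gen_ker (g := g)) g1; have /eqP : g 1 = 0.
    by apply: g1 => _ /Cvars[[k l] _ <-]; rewrite gx.
  by rewrite rmorph1 oner_eq0.
have BE : ideal_gen B = [set 0] by rewrite B0 ideal_gen_set0.
rewrite BE in defC.
have C0 : C = set0.
  rewrite -subset0 => c Cc; have [[k l] _ /= ckl] := Cvars _ Cc.
  have : ideal_gen C c by apply: ideal_gen_sub.
  rewrite -defC => /(_ (x i j) (ideal_gen_sub (erefl _))) /= cx0.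
  have [g gx] := evaluation_const 1.
  have /eqP : g (c * x i j) = 0 by rewrite cx0 rmorph0.
  by rewrite -ckl rmorphM !gx mulr1 oner_eq0.
have : colon [set 0] (ideal_gen [set x i j]) q.
  move=> z [k [c [a [ha ->]]]]; rewrite /= mulr_sumr big1 // => t _.
  by rewrite ha mulrCA qx0 mulr0.
by rewrite defC C0 ideal_gen_set0.
Qed.

Lemma minor_neq0 a b k l : k != l -> a != b -> ~~ (e1 a b && e2 k l) ->
  x a k * x b l - x a l * x b k != 0.
Proof.
move=> kl ab nab; have [sym1 irr1] := G1; have [sym2 irr2] := G2.
have [|g gx] := evaluation_indicator
  (P := fun i j => ((i == a) && (j == k)) || ((i == b) && (j == l))).
  move=> i j s t /orP[]/andP[/eqP-> /eqP->] /orP[]/andP[/eqP-> /eqP->];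
    by rewrite ?irr1 ?irr2 ?(sym2 l) ?(sym1 b) ?andbb.
apply/eqP => /(congr1 g)/eqP; rewrite rmorph0 rmorphB !rmorphM !gx !eqxx.
by rewrite (eq_sym b a) (negPf ab) (eq_sym l k) (negPf kl) mul0r subr0 mulr1 oner_eq0.
Qed.

Hypotheses (c1 : connected_graph e1) (c2 : connected_graph e2).
Hypothesis U : c_universally_Koszul (binomial_edge_ring_grading K e1 e2)
    (binomial_edge_ring_vars K e1 e2).

(** For an induced path a - b - c, the two edges let x_bk be traded across each
    term of the minor on rows a, c and columns k, l:
    x_ak x_cl x_bk = x_ak x_bl x_ck = x_al x_bk x_ck. *)
Lemma c_universally_Koszul_complete_l k l : e2 k l -> complete_graph e1.
Proof.
move=> ekl; apply: contrapT => /(connected_induced_path c1)[a [b [c [ab bc ac nac]]]].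
have kl : k != l by apply: contraTneq ekl => ->; have [_ ->] := G2.
have nonedge : ~~ (e1 a c && e2 k l) by rewrite (negPf nac).
have /negP[] := minor_neq0 kl ac nonedge.
apply/eqP/(var_nonzerodivisor U (i := b) (j := k)).
exact: minor_annihilated (var_swap K G1 G2 ab ekl) (var_swap K G1 G2 bc ekl).
Qed.

Lemma c_universally_Koszul_complete_r i j : e1 i j -> complete_graph e2.
Proof.
move=> eij; apply: contrapT => /(connected_induced_path c2)[k [l [p [kl lp kp nkp]]]].
have ij : i != j by apply: contraTneq eij => ->; have [_ ->] := G1.
have nonedge : ~~ (e1 i j && e2 k p) by rewrite (negPf nkp) andbF.
have /negP[] := minor_neq0 kp ij nonedge.
(* Transposed, the path k - l - p gives
   x_ik x_jp x_il = x_ik x_ip x_jl = x_il x_jk x_ip. *)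
apply/eqP/(var_nonzerodivisor U (i := i) (j := l)); rewrite [x i p * _]mulrC.
apply: (minor_annihilated (v := x j l)); first by rewrite (var_swap K G1 G2 eij kl) mulrC.
by rewrite (var_swap K G1 G2 eij lp) mulrC.
Qed.

End Converse.

Theorem proposition3p6 (K : fieldType) (m n : nat)
  (hm : (3 <= m)%N) (hn : (3 <= n)%N)
  (e1 : rel 'I_m) (e2 : rel 'I_n)
  (G1 : simple_graph e1) (G2 : simple_graph e2)
  (c1 : connected_graph e1) (c2 : connected_graph e2) :
  c_universally_Koszul (binomial_edge_ring_grading K e1 e2)
                       (binomial_edge_ring_vars K e1 e2)
  <-> complete_graph e1 /\ complete_graph e2.
Proof.
split=> [U|[h1 h2]]; last exact: complete_c_universally_Koszul.
have edge p (e : rel 'I_p) : (3 <= p)%N -> connected_graph e -> exists i j, e i j.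
  case: p e => [|[|p]] // e _ conn.
  by have [j ej] := connected_neighbor (x := ord0) (y := ord_max) conn isT; exists ord0, j.
have [i [j eij]] := edge _ _ hm c1; have [k [l ekl]] := edge _ _ hn c2.
split; first exact: (c_universally_Koszul_complete_l G1 G2 c1 U ekl).
exact: (c_universally_Koszul_complete_r G1 G2 c2 U eij).
Qed.
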